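(* Let $d\ge 1$ be an integer and let $\vec{\mu}=(\mu_0,\dots,\mu_{d-1})$ be a probability distribution. Let $\mathcal{O}_{\vec{\mu}}$ be the generalized platypus channel associated with $\vec{\mu}$. Then the quantum capacity of $\mathcal{O}_{\vec{\mu}}$ satisfies $$Q(\mathcal{O}_{\vec{\mu}})\le \log\Big(1+\sqrt{\max_i \mu_i}\Big).$$
   Context: Logarithms are base 2. Generalized platypus channel: let $A$ and $B$ be $(d+1)$-dimensional Hilbert spaces with computational bases $\{|i\rangle\}_{i=0}^{d}$ and $E$ a $d$-dimensional Hilbert space with basis $\{|j\rangle\}_{j=0}^{d-1}$. Define the isometry $V:A\to B\otimes E$ by $V|0\rangle=\sum_{j=0}^{d-1}\sqrt{\mu_j}\,|j\rangle_B\otimes|j\rangle_E$ and $V|i\rangle=|d\rangle_B\otimes|i-1\rangle_E$ for $i=1,\dots,d$. Then $\mathcal{O}_{\vec{\mu}}(\rho)=\mathrm{Tr}_E(V\rho V^\dagger)$, with complementary channel $\mathcal{O}_{\vec{\mu}}^c(\rho)=\mathrm{Tr}_B(V\rho V^\dagger)$. For a channel $\mathcal{N}$ with Stinespring isometry and complementary channel $\mathcal{N}^c$, the coherent information is $Q^{(1)}(\mathcal{N})=\max_\rho [S(\mathcal{N}(\rho))-S(\mathcal{N}^c(\rho))]$ ($S$ = von Neumann entropy), and the quantum capacity is $Q(\mathcal{N})=\lim_{n\to\infty}\frac1n Q^{(1)}(\mathcal{N}^{\otimes n})$. *)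

(* Defs.v *)
From HB Require Import structures.
From mathcomp Require Import all_boot all_order all_algebra.
From mathcomp Require Import complex.
From mathcomp Require Import boolp classical_sets reals topology normedtype
  sequences exp.

Set Implicit Arguments.
Unset Strict Implicit.
Unset Printing Implicit Defensive.

Import Order.TTheory GRing.Theory Num.Theory Num.Def.
Local Open Scope ring_scope.
Import numFieldNormedType.Exports.
Local Open Scope classical_set_scope.

Definition xlog2x {R : realType} (x : R) : R :=
  if x == 0 then 0 else x * (ln x / ln 2).

Definition log2 {R : realType} (x : R) : R := ln x / ln 2.

Definition is_density {R : realType} (n : nat) (M : 'M[R[i]]_n) : Prop :=
  M \is hermsymmx /\
  (forall v : 'cV[R[i]]_n, 0 <= (map_mx conjC (v^T) *m M *m v) 0 0) /\
  \tr M = 1.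

Definition vN_entropy {R : realType} (n : nat) (M : 'M[R[i]]_n) : R :=
  - \sum_(k < n) xlog2x (complex.Re (spectral_diag M 0 k)).

(* A channel given by a Stinespring isometry V : A -> B (x) E, encoded by its
   coefficients  W a b e = <b|<e| V |a>, with finite index types for the
   bases of A, B, E.  Operators on a space with basis T are matrices of
   size #|T| indexed via enum_rank / enum_val. *)
Definition chan_out {R : realType} {TA TB TE : finType}
  (W : TA -> TB -> TE -> R[i]) (rho : 'M[R[i]]_#|TA|) : 'M[R[i]]_#|TB| :=
  \matrix_(i, j) \sum_(e : TE) \sum_(a : TA) \sum_(a' : TA)
     W a (enum_val i) e * rho (enum_rank a) (enum_rank a')
       * (W a' (enum_val j) e)^*.

Definition chan_comp {R : realType} {TA TB TE : finType}
  (W : TA -> TB -> TE -> R[i]) (rho : 'M[R[i]]_#|TA|) : 'M[R[i]]_#|TE| :=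
  \matrix_(i, j) \sum_(b : TB) \sum_(a : TA) \sum_(a' : TA)
     W a b (enum_val i) * rho (enum_rank a) (enum_rank a')
       * (W a' b (enum_val j))^*.

Definition coh_info {R : realType} {TA TB TE : finType}
  (W : TA -> TB -> TE -> R[i]) : R :=
  sup [set x : R | exists rho : 'M[R[i]]_#|TA|,
        is_density rho /\
        x = vN_entropy (chan_out W rho) - vN_entropy (chan_comp W rho)].

(* n-fold tensor power of the Stinespring isometry: V^{(x)n} : A^n -> B^n (x) E^n
   (environment of N^{(x)n} is E^n). Basis of X^n = functions 'I_n -> TX. *)
Definition iso_tpow {R : realType} {TA TB TE : finType} (n : nat)
  (W : TA -> TB -> TE -> R[i]) :
  {ffun 'I_n -> TA} -> {ffun 'I_n -> TB} -> {ffun 'I_n -> TE} -> R[i] :=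
  fun as_ bs es => \prod_(k < n) W (as_ k) (bs k) (es k).

Arguments iso_tpow {R TA TB TE} n W _ _ _.

Definition qcap {R : realType} {TA TB TE : finType}
  (W : TA -> TB -> TE -> R[i]) : R :=
  limn (fun n : nat => coh_info (iso_tpow n.+1 W) / n.+1%:R).

(* generalized platypus isometry: A = B = C^{d+1}, E = C^d,
   V|0> = sum_j sqrt(mu_j) |j>_B |j>_E,  V|i> = |d>_B |i-1>_E (i>=1) *)
Definition platypus_iso {R : realType} (d : nat) (mu : 'I_d -> R) :
  'I_d.+1 -> 'I_d.+1 -> 'I_d -> R[i] :=
  fun a b e =>
    if val a == 0%N then
      (if val b == val e then (Num.sqrt (mu e))%:C%C else 0)
    else
      (if (val b == d) && (val e == (val a).-1) then 1 else 0).

(* Main.v *)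
(* If a state of R (x) B satisfies [rho_RB <= 1 (x) om], then the coherent
   information S(B) - S(RB) is at most [log (tr om)].  Indeed, if [e_k], [phi_k]
   are the eigenvalues and eigenvectors of [rho_RB], and [w_i], [f_i] those of
   [om], then [e_k * sum_i p(i|k) / w_i <= 1] for [p(i|k)] the squared norm of
   [phi_k] on R (x) f_i; combine this with [ln x <= x - 1] and with the fact
   that measuring B in the basis [f_i] does not decrease its entropy.

   Such an [om] is obtained for every input state at once from a factorisation
   [sum_s |g_s><h_s|] of the partial transpose of the Choi matrix: AM-GM gives
   the operator inequality with [om] the output of
   [1/2 * sum_s (|g_s><g_s| + |h_s><h_s|)], and [tr om <= L] as soon as the
   partial traces over B of both sums are diagonal and bounded by [L].
   Factorisations tensorise, so the n-th coherent information is at most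
   [n * log L].  For the platypus channel, the vectors [u] and [|0,d>] swapped
   by the partial transpose can be weighted against each other, and balancing
   the two partial traces yields [L = 1 + sqrt (max mu)]. *)
Require Import Defs.
From HB Require Import structures.
From mathcomp Require Import all_boot all_order all_algebra.
From mathcomp Require Import complex.
From mathcomp Require Import boolp classical_sets reals topology normedtype
  sequences exp.
From mathcomp Require Import ring lra.
Set Implicit Arguments.
Unset Strict Implicit.
Unset Printing Implicit Defensive.

Import Order.TTheory GRing.Theory Num.Theory.
Import numFieldNormedType.Exports.
Local Open Scope ring_scope.

(** * Entropy inequalities for distributions *)

Section Entropy.
Variables (R : realType).

Lemma ln_sub_le (x y : R) : 0 < x -> 0 < y -> ln x - ln y <= x / y - 1.
Proof.
move=> x0 y0; rewrite -ln_div//.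
have /le_ln1Dx : -1 < x / y - 1 by rewrite ltrBrDr addNr divr_gt0.
by rewrite [1 + _]addrC subrK.
Qed.

(** Jensen for x ln x, done termwise: [ln_sub_le] gives b_j (ln q_i - ln b_j) <= q_i - b_j. Weighted
    by [D i j], the right-hand sides cancel because rows sum to 1, while the column sums allow b_j
    ln b_j to be spread over [i]. *)
Lemma bistochastic_entropy (I J : finType) (D : I -> J -> R) (b : J -> R)
    (q : I -> R) :
  (forall i j, 0 <= D i j) -> (forall j, 0 <= b j) ->
  (forall i, \sum_j D i j = 1) -> (forall j, \sum_i D i j = 1) ->
  (forall i, q i = \sum_j D i j * b j) ->
  \sum_i q i * ln (q i) <= \sum_j b j * ln (b j).
Proof.
move=> D0 b0 Drow Dcol qE.
have q0 i : 0 <= q i by rewrite qE; apply: sumr_ge0 => j _; rewrite mulr_ge0.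
have -> : \sum_i q i * ln (q i) = \sum_i \sum_j D i j * b j * ln (q i).
  by apply: eq_bigr => i _; rewrite -mulr_suml -qE.
have -> : \sum_j b j * ln (b j) = \sum_i \sum_j D i j * b j * ln (b j).
  rewrite exchange_big; apply: eq_bigr => j _ /=.
  by under eq_bigr do rewrite -mulrA; rewrite -mulr_suml Dcol mul1r.
rewrite -subr_ge0 -sumrB.
apply: (@le_trans _ _ (\sum_i \sum_j (D i j * b j - D i j * q i))).
  rewrite big1 // => i _; by rewrite sumrB -mulr_suml Drow mul1r -qE subrr.
apply: ler_sum => i _; rewrite -sumrB; apply: ler_sum => j _.
have [->|Dn0] := eqVneq (D i j) 0; first by rewrite !mul0r subrr.
have Dp : 0 < D i j by rewrite lt_neqAle eq_sym Dn0 D0.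
have [->|bn0] := eqVneq (b j) 0.
  by rewrite mulr0 !mul0r sub0r subrr oppr_le0 mulr_ge0.
have bp : 0 < b j by rewrite lt_neqAle eq_sym bn0 b0.
have qp : 0 < q i.
  rewrite qE (bigD1 j)//= ltr_pwDl ?mulr_gt0//.
  by apply: sumr_ge0 => k _; rewrite mulr_ge0.
have H : b j * (ln (q i) - ln (b j)) <= q i - b j.
  have -> : q i - b j = b j * (q i / b j - 1) by field; rewrite gt_eqF.
  by rewrite ler_pM2l// ln_sub_le.
rewrite -mulrBr -mulrBr -mulrA ler_pM2l//; lra.
Qed.

(** Split ln e_j - ln q_i as ln (e_j / w_i) + ln (w_i / (q_i L)) + ln L and bound the first two
    logarithms by x - 1. Averaged over the joint distribution [t], both ratios are at most 1: the
    first by sum_i t_ij / w_i <= 1, the second by sum_i w_i <= L. *)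
Lemma joint_entropy_bound (I J : finType) (t : I -> J -> R) (w : I -> R)
    (q : I -> R) (e : J -> R) (L : R) :
  (forall i j, 0 <= t i j) -> (forall i, 0 <= w i) ->
  \sum_i \sum_j t i j = 1 ->
  (forall i j, w i = 0 -> t i j = 0) ->
  (forall j, \sum_i t i j / w i <= 1) ->
  0 < L -> \sum_i w i <= L ->
  (forall i, q i = \sum_j t i j) -> (forall j, e j = \sum_i t i j) ->
  \sum_j e j * ln (e j) - \sum_i q i * ln (q i) <= ln L.
Proof.
move=> t0 w0 t1 wt0 tw1 L0 wL qE eE.
have q0 i : 0 <= q i by rewrite qE sumr_ge0.
have e0 j : 0 <= e j by rewrite eE sumr_ge0.
have -> : \sum_j e j * ln (e j) = \sum_i \sum_j t i j * ln (e j).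
  by rewrite exchange_big; apply: eq_bigr => j _; rewrite -mulr_suml -eE.
have -> : \sum_i q i * ln (q i) = \sum_i \sum_j t i j * ln (q i).
  by apply: eq_bigr => i _; rewrite -mulr_suml -qE.
rewrite -sumrB; under eq_bigr do rewrite -sumrB.
(* The termwise bound, expanded so that each division stays attached to t_ij: it vanishes when t_ij
   = 0, the only case where w_i or q_i may be 0. *)
pose f i j := (e j * (t i j / w i) - t i j) + (t i j / q i * w i / L - t i j)
   + t i j * ln L.
apply: (@le_trans _ _ (\sum_i \sum_j f i j)).
  apply: ler_sum => i _; apply: ler_sum => j _.
  have [E|tn0] := eqVneq (t i j) 0; first by rewrite /f E !mul0r mulr0; lra.
  have tp : 0 < t i j by rewrite lt_neqAle eq_sym tn0 t0.
  have wp : 0 < w i.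
    by rewrite lt_neqAle eq_sym w0 andbT; apply: contra_neq tn0; apply: wt0.
  have qp : 0 < q i by rewrite qE (bigD1 j)//= ltr_pwDl// sumr_ge0.
  have ep : 0 < e j by rewrite eE (bigD1 i)//= ltr_pwDl// sumr_ge0.
  have H1 := ln_sub_le ep wp.
  have H2 := ln_sub_le wp (mulr_gt0 qp L0); rewrite lnM ?posrE// in H2.
  have -> : f i j = t i j * ((e j / w i - 1) + (w i / (q i * L) - 1) + ln L).
    by rewrite /f; field; rewrite !gt_eqF.
  rewrite -mulrBr ler_pM2l//; lra.
have -> : \sum_i \sum_j f i j = (\sum_i \sum_j e j * (t i j / w i) - 1)
    + (\sum_i (\sum_j t i j / q i * w i) / L - 1) + ln L.
  rewrite -{1 2}t1 -[ln L in RHS]mul1r -[X in X * ln L]t1 mulr_suml -!sumrB -!big_split.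
  apply: eq_bigr => i _ /=; rewrite !mulr_suml -!sumrB -!big_split.
  by apply: eq_bigr.
have E2 : \sum_i \sum_j e j * (t i j / w i) <= 1.
  have <- : \sum_j e j = 1 by under eq_bigr do rewrite eE; rewrite exchange_big.
  rewrite exchange_big; apply: ler_sum => j _ /=.
  by rewrite -mulr_sumr ler_piMr.
have E3 : \sum_i (\sum_j t i j / q i * w i) / L <= 1.
  rewrite -mulr_suml ler_pdivrMr// mul1r; apply: le_trans wL.
  apply: ler_sum => i _; rewrite -!mulr_suml -qE.
  have [->|qn0] := eqVneq (q i) 0; first by rewrite !mul0r.
  by rewrite divff// mul1r.
lra.
Qed.
End Entropy.

(** * Spectral decomposition *)

Section Spectral.
Local Open Scope sesquilinear_scope.
Variable R : realType.
Local Notation C := R[i].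

Lemma mulmxtC_diag m n (A : 'M[C]_(m, n)) i :
  (A *m A^t*) i i = \sum_j `|A i j| ^+ 2.
Proof. by rewrite mxE; apply: eq_bigr => j _; rewrite !mxE -normCK. Qed.

Lemma unitarymx_tCmul n (U : 'M[C]_n) : U \is unitarymx -> U^t* *m U = 1%:M.
Proof. by move=> Uu; rewrite -invmx_unitary// mulVmx// unitarymx_unit. Qed.

Lemma unitarymx_trmul n (U : 'M[C]_n) : U \is unitarymx -> U^T *m (U^T)^t* = 1%:M.
Proof. by move=> Uu; apply/unitarymxP; rewrite trmx_unitary. Qed.

Lemma trmxC_mul m n p (A : 'M[C]_(m, n)) (B : 'M[C]_(n, p)) :
  (A *m B)^t* = B^t* *m A^t*.
Proof. by rewrite trmx_mul map_mxM. Qed.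

Lemma spectral_diagE n (A : 'M[C]_n) : A \is hermsymmx ->
  spectralmx A *m A *m (spectralmx A)^t* = diag_mx (spectral_diag A).
Proof.
move=> /hermitian_normalmx/orthomx_spectralP AE.
have Uu := spectral_unitarymx A.
rewrite {2}AE invmx_unitary// !mulmxA (unitarymxP Uu) mul1mx -mulmxA.
by rewrite (unitarymxP Uu) mulmx1.
Qed.

Lemma spectral_diag_Re n (A : 'M[C]_n) k : A \is hermsymmx ->
  spectral_diag A 0 k = (complex.Re (spectral_diag A 0 k))%:C%C.
Proof.
by move=> /hermitian_spectral_diag_real/mxOverP/(_ 0 k) Ar; rewrite RRe_real.
Qed.

Lemma gram_hermsymmx (I : finType) m n (A : I -> 'M[C]_(m, n)) :
  \sum_r A r *m (A r)^t* \is hermsymmx.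
Proof.
apply/is_hermitianmxP; rewrite expr0 scale1r linear_sum /= raddf_sum /=.
by apply: eq_bigr => r _; rewrite trmxC_mul trmxCK.
Qed.

Lemma vN_entropyE n (A : 'M[C]_n) : vN_entropy A =
  - (\sum_k complex.Re (spectral_diag A 0 k) * ln (complex.Re (spectral_diag A 0 k)))
  / ln 2.
Proof.
rewrite /vN_entropy mulNr mulr_suml; congr (- _); apply: eq_bigr => k _.
by rewrite /xlog2x; case: eqP => [->|_]; rewrite ?mul0r ?mulrA.
Qed.

End Spectral.

(** * Entropy difference of two marginals of a pure state *)

Section EntropyDiff.
Local Open Scope sesquilinear_scope.
Variable R : realType.
Local Notation C := R[i].

(** Measuring does not decrease entropy: [q] is the image of the spectrum of [A] under the matrix of
    squared moduli of the unitary O = U P^*, with P the diagonalising matrix of [A]. This matrix is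
    doubly stochastic, so [bistochastic_entropy] applies. *)
Lemma vN_entropy_pinching n (A U : 'M[C]_n) (q : 'I_n -> R) :
  A \is hermsymmx -> (forall v : 'rV_n, 0 <= (v *m A *m v^t*) 0 0) ->
  U \is unitarymx -> (forall i, (U *m A *m U^t*) i i = (q i)%:C%C) ->
  vN_entropy A <= - (\sum_i q i * ln (q i)) / ln 2.
Proof.
move=> Ah A0 Uu qE; rewrite vN_entropyE ler_pM2r ?invr_gt0 ?ln_gt0 ?ltr1n//.
rewrite lerN2.
have Pu := spectral_unitarymx A; set P := spectralmx A in Pu.
pose O := U *m P^t*.
have Ou : O *m O^t* = 1%:M.
  rewrite /O trmxC_mul trmxCK !mulmxA -[U *m _ *m _]mulmxA unitarymx_tCmul//.
  by rewrite mulmx1 (unitarymxP Uu).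
have Ou' : O^t* *m (O^t*)^t* = 1%:M.
  by rewrite trmxCK; apply: unitarymx_tCmul; apply/unitarymxP.
have OE : U *m A *m U^t* = O *m diag_mx (spectral_diag A) *m O^t*.
  rewrite -spectral_diagE// /O trmxC_mul trmxCK -/P !mulmxA.
  rewrite -[U *m _ *m P]mulmxA unitarymx_tCmul// mulmx1.
  by rewrite -[_ *m P^t* *m P]mulmxA unitarymx_tCmul// mulmx1.
clearbody O.
pose D i j := complex.Re (`|O i j| ^+ 2).
have DE i j : (D i j)%:C%C = `|O i j| ^+ 2.
  by rewrite /D RRe_real// realE exprn_ge0.
apply: (bistochastic_entropy (D := D)).
- by move=> i j; rewrite -ler0c DE exprn_ge0.
- move=> j; rewrite -ler0c -spectral_diag_Re//.
  have := A0 (row j P); rewrite -row_mul.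
  have -> : (row j (P *m A) *m (row j P)^t*) 0 0 = (P *m A *m P^t*) j j.
    by rewrite !mxE; apply: eq_bigr => k _; rewrite !mxE.
  by rewrite spectral_diagE// !mxE eqxx mulr1n.
- move=> i; apply: (@complexI R); rewrite rmorph_sum /=.
  under eq_bigr do rewrite DE.
  by rewrite -mulmxtC_diag Ou mxE eqxx.
- move=> j; apply: (@complexI R); rewrite rmorph_sum rmorph1 /=.
  have := mulmxtC_diag (O^t*) j; rewrite Ou' mxE eqxx mulr1n => ->.
  by apply: eq_bigr => i _; rewrite DE !mxE norm_conjC.
- move=> i; apply: (@complexI R); rewrite -qE OE rmorph_sum /= mxE.
  apply: eq_bigr => j _; rewrite mul_mx_diag !mxE rmorphM/= DE -spectral_diag_Re//.
  by rewrite normCK mulrAC.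
Qed.

(** [Psi r] is the component along |r> of a pure state of R (x) B (x) E. The two sums are its
    marginals on B and E, and S(E) = S(RB) by purity. The hypothesis on [y] is rho_RB <= 1 (x) om,
    tested on the bra with components [y r]. *)
Lemma vN_entropy_sub_le (I : finType) m n (Psi : I -> 'M[C]_(m, n))
    (om : 'M[C]_m) (L : R) :
  \tr (\sum_r Psi r *m (Psi r)^t*) = 1 ->
  om \is hermsymmx -> (forall v : 'rV_m, 0 <= (v *m om *m v^t*) 0 0) ->
  0 < L -> \tr om <= L%:C%C ->
  (forall y : I -> 'rV[C]_m,
     ((\sum_r y r *m Psi r) *m (\sum_r y r *m Psi r)^t*) 0 0
       <= \sum_r (y r *m om *m (y r)^t*) 0 0) ->
  vN_entropy (\sum_r Psi r *m (Psi r)^t*)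
    - vN_entropy (\sum_r (Psi r)^T *m ((Psi r)^T)^t*) <= ln L / ln 2.
Proof.
set rB := \sum_r Psi r *m _; set rE := \sum_r (Psi r)^T *m _.
move=> tr1 omh om0 L0 trL H.
have rBh : rB \is hermsymmx by apply: gram_hermsymmx.
have rEh : rE \is hermsymmx by apply: gram_hermsymmx.
pose U := spectralmx om; pose Q := spectralmx rE.
have Uu : U \is unitarymx by apply: spectral_unitarymx.
have Qu : Q \is unitarymx by apply: spectral_unitarymx.
pose Phi r := U *m Psi r *m Q^T.
(* Joint distribution of the outcomes when B is measured in the eigenbasis of [om] and E in that of
   [rE]. Its E-marginal is the spectrum of [rE]; its B-marginal [q] has entropy at least S(B). *)
pose t i k := complex.Re (\sum_r `|Phi r i k| ^+ 2).
have tE i k : (t i k)%:C%C = \sum_r `|Phi r i k| ^+ 2.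
  by rewrite /t RRe_real// realE sumr_ge0// => r _; rewrite exprn_ge0.
pose w i := complex.Re (spectral_diag om 0 i).
have wE i : (w i)%:C%C = spectral_diag om 0 i by rewrite -spectral_diag_Re.
pose e k := complex.Re (spectral_diag rE 0 k).
have eE k : e k = \sum_i t i k.
  apply: (@complexI R); rewrite -spectral_diag_Re// rmorph_sum /=.
  under eq_bigr do rewrite tE.
  have -> : spectral_diag rE 0 k = diag_mx (spectral_diag rE) k k.
    by rewrite mxE eqxx mulr1n.
  rewrite -spectral_diagE// -/Q /rE mulmx_sumr mulmx_suml summxE exchange_big /=.
  apply: eq_bigr => r _.
  have -> : Q *m ((Psi r)^T *m (Psi r)^T ^t*) *m Q^t* = (Phi r)^T *m (Phi r)^T^t*.
    have -> : (Phi r)^T = Q *m (Psi r)^T *m U^T by rewrite /Phi !trmx_mul trmxK mulmxA.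
    rewrite !trmxC_mul !mulmxA -[_ *m U^T *m _]mulmxA (unitarymx_trmul Uu).
    by rewrite mulmx1.
  by rewrite mulmxtC_diag; apply: eq_bigr => i _; rewrite mxE.
pose q i := \sum_k t i k.
have PhiPhi r : Phi r *m (Phi r)^t* = U *m (Psi r *m (Psi r)^t*) *m U^t*.
  rewrite /Phi !trmxC_mul !mulmxA -[_ *m Q^T *m _]mulmxA (unitarymx_trmul Qu).
  by rewrite mulmx1.
have qE i : (U *m rB *m U^t*) i i = (q i)%:C%C.
  rewrite /rB mulmx_sumr mulmx_suml summxE rmorph_sum /=.
  under [RHS]eq_bigr do rewrite tE; rewrite exchange_big /=.
  by apply: eq_bigr => r _; rewrite -PhiPhi mulmxtC_diag.
have rB0 (v : 'rV_m) : 0 <= (v *m rB *m v^t*) 0 0.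
  rewrite /rB mulmx_sumr mulmx_suml summxE; apply: sumr_ge0 => r _.
  rewrite !mulmxA -mulmxA -trmxC_mul mulmxtC_diag sumr_ge0// => k _.
  by rewrite exprn_ge0.
have HB := vN_entropy_pinching rBh rB0 Uu qE.
have HE : vN_entropy rE = - (\sum_k e k * ln (e k)) / ln 2 by exact: vN_entropyE.
have ln20 : 0 < (ln 2 : R) by rewrite ln_gt0 ?ltr1n.
have t0 i k : 0 <= t i k.
  by rewrite -ler0c tE sumr_ge0// => r _; rewrite exprn_ge0.
(* The operator inequality, tested on vectors given in the eigenbasis of [om]. *)
have Hz (z : I -> 'rV[C]_m) :
    \sum_k `|\sum_r (z r *m Phi r) 0 k| ^+ 2
      <= \sum_r \sum_i spectral_diag om 0 i * `|z r 0 i| ^+ 2.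
  have := H (fun r => z r *m U).
  have -> : \sum_r z r *m U *m Psi r = (\sum_r z r *m Phi r) *m (Q^T)^t*.
    rewrite mulmx_suml; apply: eq_bigr => r _; rewrite /Phi !mulmxA.
    by rewrite -[_ *m Q^T *m _]mulmxA (unitarymx_trmul Qu) mulmx1.
  rewrite trmxC_mul trmxCK mulmxA -[_ *m (Q^T)^t* *m _]mulmxA.
  rewrite unitarymx_tCmul ?trmx_unitary// mulmx1 mulmxtC_diag.
  under eq_bigr do rewrite summxE.
  move=> /le_trans; apply; rewrite le_eqVlt; apply/orP; left; apply/eqP.
  apply: eq_bigr => r _.
  rewrite trmxC_mul -!mulmxA [om *m _]mulmxA [U *m _]mulmxA [U *m _]mulmxA.
  rewrite spectral_diagE// mulmxA mul_mx_diag mxE; apply: eq_bigr => i _.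
  by rewrite !mxE normCK mulrAC mulrC.
(* Test vectors with entries conj (Phi r i k) c_i turn the k-th term on the left of [Hz] into the
   square of sum_i t_ik c_i; the other terms are dropped. *)
have Hc (c : 'I_m -> R) k :
    (\sum_i t i k * c i) ^+ 2 <= \sum_i w i * (c i ^+ 2 * t i k).
  have := Hz (fun r => \row_i ((Phi r i k)^* * (c i)%:C%C)).
  rewrite exchange_big /=.
  have -> : \sum_i \sum_r spectral_diag om 0 i
      * `|(\row_i0 ((Phi r i0 k)^* * (c i0)%:C%C)) 0 i| ^+ 2
      = (\sum_i w i * (c i ^+ 2 * t i k))%:C%C.
    rewrite rmorph_sum; apply: eq_bigr => i _ /=.
    rewrite -mulr_sumr !rmorphM/= wE; congr (_ * _).
    rewrite tE mulr_sumr; apply: eq_bigr => r _.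
    rewrite mxE normrM exprMn norm_conjC mulrC; congr (_ * _).
    by rewrite normCK conj_Creal ?rmorphXn//= complex_real.
  rewrite -lecR; apply: le_trans.
  rewrite (bigD1 k)//= ler_wpDr//; first by rewrite sumr_ge0// => j _; rewrite exprn_ge0.
  have -> : \sum_r ((\row_i ((Phi r i k)^* * (c i)%:C%C)) *m Phi r) 0 k
      = (\sum_i t i k * c i)%:C%C.
    under eq_bigr do rewrite mxE.
    rewrite exchange_big rmorph_sum; apply: eq_bigr => i _ /=.
    rewrite rmorphM /= tE mulr_suml; apply: eq_bigr => r _.
    by rewrite mxE normCK mulrAC [_^* * _]mulrC.
  by rewrite rmorphXn/= normCK conj_Creal ?complex_real.
have w0 i : 0 <= w i.
  have := om0 (row i U); rewrite -row_mul.
  have -> : (row i (U *m om) *m (row i U)^t*) 0 0 = (U *m om *m U^t*) i i.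
    by rewrite !mxE; apply: eq_bigr => k _; rewrite !mxE.
  by rewrite spectral_diagE// mxE eqxx mulr1n -wE ler0c.
have tq1 : \sum_i \sum_k t i k = 1.
  apply: (@complexI R); rewrite rmorph1 -tr1 -[rB]mul1mx -(unitarymx_tCmul Uu).
  rewrite -mulmxA mxtrace_mulC /mxtrace rmorph_sum /=.
  by apply: eq_bigr => i _; rewrite qE.
(* Taking for [c] the indicator of [i] gives t_ik^2 <= w_i t_ik. *)
have wt0 i k : w i = 0 -> t i k = 0.
  move=> wi0; have := Hc (fun j => (j == i)%:R) k.
  rewrite (bigD1 i)//= big1 => [|j /negPf->]; last by rewrite mulr0.
  rewrite eqxx mulr1 addr0 (bigD1 i)//= big1 => [|j /negPf->]; last first.
    by rewrite expr0n mul0r mulr0.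
  rewrite wi0 mul0r addr0 => tle0; apply/eqP; rewrite -sqrf_eq0.
  by rewrite eq_le tle0 sqr_ge0.
(* Taking c = 1/w gives s^2 <= s for the sum s, hence s <= 1. Where w_i = 0, the inverse is 0 by
   convention and t_ik is 0 too. *)
have tw1 k : \sum_i t i k / w i <= 1.
  have := Hc (fun i => (w i)^-1) k.
  have -> : \sum_i w i * ((w i)^-1 ^+ 2 * t i k) = \sum_i t i k / w i.
    apply: eq_bigr => i _; have [E|wn0] := eqVneq (w i) 0.
      by rewrite (wt0 i k E) !mul0r !mulr0.
    by field.
  set s := \sum_i _ => ss; rewrite leNgt; apply/negP => s1.
  have s0 := lt_trans ltr01 s1.
  by move: ss; rewrite leNgt expr2 ltr_pMr// s1.
have wL : \sum_i w i <= L.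
  rewrite -lecR rmorph_sum /=; apply: le_trans trL.
  rewrite le_eqVlt; apply/orP; left; apply/eqP.
  rewrite -[om in RHS]mul1mx -(unitarymx_tCmul Uu).
  rewrite -mulmxA mxtrace_mulC spectral_diagE// mxtrace_diag.
  by apply: eq_bigr => i _; rewrite wE.
have := joint_entropy_bound t0 w0 tq1 wt0 tw1 L0 wL (fun i => erefl) eE.
move=> J; apply: le_trans (_ : (\sum_k e k * ln (e k) - \sum_i q i * ln (q i)) / ln 2 <= _).
  by rewrite HE; lra.
by rewrite ler_pM2r ?invr_gt0.
Qed.
End EntropyDiff.

(** * Factorisations of the partially transposed Choi matrix *)

Section Cert.
Local Open Scope sesquilinear_scope.
Variable R : realType.
Local Notation C := R[i].

(** This provides a purification: the column index of [X] plays the role of the reference system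
    R. *)
Lemma density_factor n (rho : 'M[C]_n) : is_density rho ->
  exists X : 'M[C]_n, rho = X *m X^t*.
Proof.
case=> rhoh [rho0 _].
have Pu := spectral_unitarymx rho; set P := spectralmx rho in Pu.
pose D := spectral_diag rho.
have DE : P *m rho *m P^t* = diag_mx D by apply: spectral_diagE.
have D0 k : 0 <= D 0 k.
  have -> : D 0 k = (P *m rho *m P^t*) k k by rewrite DE mxE eqxx mulr1n.
  have := rho0 ((row k P)^t*); congr (0 <= _).
  rewrite -/(((row k P)^t*)^t*) trmxCK -row_mul.
  by rewrite !mxE; apply: eq_bigr => l _; rewrite !mxE.
exists (P^t* *m diag_mx (map_mx sqrtC D)).
rewrite trmxC_mul trmxCK -mulmxA [_ *m (_ *m P)]mulmxA.
have -> : diag_mx (map_mx sqrtC D) *m (diag_mx (map_mx sqrtC D))^t* = diag_mx D.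
  rewrite tr_diag_mx map_diag_mx mulmx_diag; congr diag_mx; apply/rowP => k.
  by rewrite !mxE /= conj_Creal ?ger0_real ?sqrtC_ge0// -expr2 sqrtCK.
rewrite -DE !mulmxA unitarymx_tCmul// mul1mx -mulmxA unitarymx_tCmul// mulmx1.
by [].
Qed.

Lemma sum_mul3 (I1 I2 I3 : finType) (f g : I1 -> I2 -> I3 -> C) :
  (\sum_i \sum_j \sum_k f i j k) * (\sum_i \sum_j \sum_k g i j k)
  = \sum_i \sum_i' \sum_j \sum_j' \sum_k \sum_k' f i j k * g i' j' k'.
Proof.
rewrite mulr_suml; apply: eq_bigr => i _.
rewrite mulr_sumr; apply: eq_bigr => i' _.
rewrite mulr_suml; apply: eq_bigr => j _.
rewrite mulr_sumr; apply: eq_bigr => j' _.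
rewrite mulr_suml; apply: eq_bigr => k _.
by rewrite mulr_sumr.
Qed.

Lemma sum_mul2 (I1 I2 : finType) (f g : I1 -> I2 -> C) :
  (\sum_i \sum_j f i j) * (\sum_i \sum_j g i j)
  = \sum_i \sum_i' \sum_j \sum_j' f i j * g i' j'.
Proof.
rewrite mulr_suml; apply: eq_bigr => i _.
rewrite mulr_sumr; apply: eq_bigr => i' _.
rewrite mulr_suml; apply: eq_bigr => j _.
by rewrite mulr_sumr.
Qed.

Lemma mulmx3E m n p q (A : 'M[C]_(m, n)) (B : 'M[C]_(n, p)) (D : 'M[C]_(p, q)) i j :
  (A *m B *m D) i j = \sum_k \sum_l A i k * B k l * D l j.
Proof.
rewrite -mulmxA mxE; apply: eq_bigr => k _; rewrite mxE mulr_sumr.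
by apply: eq_bigr => l _; rewrite mulrA.
Qed.

(** In the expanded square, [a] comes with [r] and [a'] with [r']. The hypothesis exchanges [a] and
    [a'], so [g] meets conj X at [r'] and [h] meets it at [r]: this is why [X] gets conjugated and
    the entries are taken at crossed positions. *)
Lemma twisted_trace_identity (E S : finType) m n p (W : E -> 'M[C]_(m, p))
    (g h : S -> 'M[C]_(m, p)) (X : 'M[C]_(p, n)) (Y : 'M[C]_(n, m)) :
  (forall b a b' a', \sum_e W e b a * (W e b' a')^*
     = \sum_s g s b a' * (h s b' a)^*) ->
  \sum_e `|\tr (Y *m W e *m X)| ^+ 2 =
  \sum_s \sum_r \sum_r' (Y *m g s *m map_mx Num.conj X) r r'
    * ((Y *m h s *m map_mx Num.conj X) r' r)^*.
Proof.
move=> WE; transitivity (\sum_r \sum_r' \sum_b \sum_b' \sum_a \sum_a'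
  Y r b * X a r * (Y r' b' * X a' r')^* * \sum_e W e b a * (W e b' a')^*).
  under eq_bigr => e _.
    rewrite normCK /mxtrace; under eq_bigr do rewrite mulmx3E.
    rewrite rmorph_sum; under [X in _ * X]eq_bigr do rewrite rmorph_sum.
    under [X in _ * X]eq_bigr do under eq_bigr do rewrite rmorph_sum.
    rewrite sum_mul3. over.
  rewrite exchange_big; apply: eq_bigr => r _ /=.
  rewrite exchange_big; apply: eq_bigr => r' _ /=.
  rewrite exchange_big; apply: eq_bigr => b _ /=.
  rewrite exchange_big; apply: eq_bigr => b' _ /=.
  rewrite exchange_big; apply: eq_bigr => a _ /=.
  rewrite exchange_big; apply: eq_bigr => a' _ /=.
  rewrite mulr_sumr; apply: eq_bigr => e _; rewrite !rmorphM /=; ring.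
rewrite [RHS]exchange_big; apply: eq_bigr => r _ /=.
rewrite [RHS]exchange_big; apply: eq_bigr => r' _ /=.
under [RHS]eq_bigr => s _.
  rewrite !mulmx3E rmorph_sum; under [X in _ * X]eq_bigr do rewrite rmorph_sum.
  rewrite sum_mul2. over.
rewrite [RHS]exchange_big; apply: eq_bigr => b _ /=.
rewrite [RHS]exchange_big; apply: eq_bigr => b' _ /=.
rewrite exchange_big [RHS]exchange_big; apply: eq_bigr => a' _ /=.
rewrite [RHS]exchange_big; apply: eq_bigr => a _ /=.
rewrite WE mulr_sumr; apply: eq_bigr => s _.
rewrite !mxE !rmorphM /= conjCK; ring.
Qed.

(* AM-GM on the right-hand side of [twisted_trace_identity]. *)
Lemma twisted_trace_le (E S : finType) m n p (W : E -> 'M[C]_(m, p))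
    (g h : S -> 'M[C]_(m, p)) (X : 'M[C]_(p, n)) (Y : 'M[C]_(n, m)) :
  (forall b a b' a', \sum_e W e b a * (W e b' a')^*
     = \sum_s g s b a' * (h s b' a)^*) ->
  \sum_e `|\tr (Y *m W e *m X)| ^+ 2 <=
  2^-1 * (\sum_s \sum_r \sum_r' `|(Y *m g s *m map_mx Num.conj X) r r'| ^+ 2
    + \sum_s \sum_r \sum_r' `|(Y *m h s *m map_mx Num.conj X) r r'| ^+ 2).
Proof.
move=> WE; rewrite -[leLHS]ger0_norm ?sumr_ge0// => [|e _]; last first.
  by rewrite exprn_ge0.
rewrite (twisted_trace_identity X Y WE) -big_split mulr_sumr.
apply: le_trans (ler_norm_sum _ _ _) _; apply: ler_sum => s _ /=.
rewrite [X in _ + X]exchange_big -big_split mulr_sumr.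
apply: le_trans (ler_norm_sum _ _ _) _; apply: ler_sum => r _ /=.
rewrite -big_split mulr_sumr.
apply: le_trans (ler_norm_sum _ _ _) _; apply: ler_sum => r' _ /=.
rewrite normrM norm_conjC.
set x := `|_|; set y := `|_|.
rewrite ler_pdivlMl ?ltr0n// -subr_ge0.
have -> : x ^+ 2 + y ^+ 2 - 2 * (x * y) = (x - y) ^+ 2 by ring.
by rewrite -realEsqr realB// normr_real.
Qed.

End Cert.

(** * From a factorisation to a bound on the coherent information *)

Section Coh.
Local Open Scope sesquilinear_scope.
Variable R : realType.
Local Notation C := R[i].

Lemma sum_enum_val (T : finType) (F : T -> C) :
  \sum_(i < #|T|) F (enum_val i) = \sum_x F x.
Proof. by rewrite [RHS](reindex _ (onW_bij _ (enum_val_bij T))). Qed.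

Definition coeff_mx (TA TB : finType) (f : TA -> TB -> C) : 'M[C]_(#|TB|, #|TA|) :=
  \matrix_(b, a) f (enum_val a) (enum_val b).

Lemma coeff_mx_conjE (TA TB TB' : finType) (f : TA -> TB -> C) (f' : TA -> TB' -> C)
    (rho : 'M[C]_#|TA|) i j :
  (coeff_mx f *m rho *m (coeff_mx f')^t*) i j =
  \sum_a \sum_a' f a (enum_val i) * rho (enum_rank a) (enum_rank a')
    * (f' a' (enum_val j))^*.
Proof.
rewrite mulmx3E -[RHS]sum_enum_val; apply: eq_bigr => k _.
rewrite -[RHS]sum_enum_val; apply: eq_bigr => l _.
by rewrite !mxE !enum_valK.
Qed.

Lemma hermsymmx_half_add n (A B : 'M[C]_n) :
  A \is hermsymmx -> B \is hermsymmx -> 2^-1 *: (A + B) \is hermsymmx.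
Proof.
move=> /is_hermitianmxP; rewrite expr0 scale1r => AE.
move=> /is_hermitianmxP; rewrite expr0 scale1r => BE.
apply/is_hermitianmxP; rewrite expr0 scale1r {1}AE {1}BE.
by apply/matrixP => i j; rewrite !mxE /= rmorphM rmorphD fmorphV rmorph_nat.
Qed.

Lemma gram_form (I : finType) m n (A : I -> 'M[C]_(m, n)) (v : 'rV[C]_m) :
  (v *m (\sum_s A s *m (A s)^t*) *m v^t*) 0 0 = \sum_s \sum_j `|(v *m A s) 0 j| ^+ 2.
Proof.
rewrite mulmx_sumr mulmx_suml summxE; apply: eq_bigr => s _.
by rewrite !mulmxA -mulmxA -trmxC_mul mulmxtC_diag.
Qed.

(** The trace over B sees the family [g] only through its partial trace, which is diagonal with
    entries [m]. Off-diagonal entries of [rho] thus drop out, leaving sum_a m_a rho_aa <= L tr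
    rho. *)
Lemma marginal_trace_le (TA TB S : finType) (g : S -> TA -> TB -> C) (m : TA -> R)
    (L : R) (X : 'M[C]_#|TA|) :
  (forall a a', \sum_s \sum_b g s a b * (g s a' b)^* = (m a)%:C%C *+ (a == a')) ->
  (forall a, m a <= L) -> \tr (X *m X^t*) = 1 ->
  \tr (\sum_s (coeff_mx (g s) *m map_mx Num.conj X)
        *m (coeff_mx (g s) *m map_mx Num.conj X)^t*) <= L%:C%C.
Proof.
move=> gE mL trX; set rho := X *m X^t* in trX.
have E s : coeff_mx (g s) *m map_mx Num.conj X *m (coeff_mx (g s) *m map_mx Num.conj X)^t*
    = coeff_mx (g s) *m map_mx Num.conj rho *m (coeff_mx (g s))^t*.
  by rewrite trmxC_mul !mulmxA /rho map_mxM map_trmx !mulmxA.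
under eq_bigr do rewrite E.
have -> : \tr (\sum_s coeff_mx (g s) *m map_mx Num.conj rho *m (coeff_mx (g s))^t*)
    = \sum_a (m a)%:C%C * (rho (enum_rank a) (enum_rank a))^*.
  rewrite raddf_sum /=; under eq_bigr => s _.
    rewrite /mxtrace; under eq_bigr do rewrite coeff_mx_conjE.
    rewrite (sum_enum_val (fun b => \sum_a \sum_a' g s a b * map_mx Num.conj rho
      (enum_rank a) (enum_rank a') * (g s a' b)^*)).
    rewrite exchange_big /=; under eq_bigr do rewrite exchange_big /=. over.
  rewrite exchange_big; apply: eq_bigr => a _ /=.
  rewrite exchange_big (bigD1 a)//= [X in _ + X]big1 ?addr0 => [|a' /negPf a'a]; last first.
    transitivity ((rho (enum_rank a) (enum_rank a'))^* *
        \sum_s \sum_b g s a b * (g s a' b)^*); last by rewrite gE eq_sym a'a mulr0.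
    rewrite mulr_sumr; apply: eq_bigr => s _; rewrite mulr_sumr.
    by apply: eq_bigr => b _; rewrite mxE; ring.
  transitivity ((rho (enum_rank a) (enum_rank a))^* *
      \sum_s \sum_b g s a b * (g s a b)^*); last by rewrite gE eqxx mulr1n mulrC.
  rewrite mulr_sumr; apply: eq_bigr => s _; rewrite mulr_sumr.
  by apply: eq_bigr => b _; rewrite mxE; ring.
rewrite -[leRHS]mulr1 -trX /mxtrace.
have -> : \sum_i rho i i = \sum_a rho (enum_rank a) (enum_rank a).
  by rewrite -[RHS]sum_enum_val; apply: eq_bigr => i _; rewrite enum_valK.
rewrite mulr_sumr; apply: ler_sum => a _.
have r0 : 0 <= rho (enum_rank a) (enum_rank a).
  by rewrite /rho mulmxtC_diag sumr_ge0// => r _; rewrite exprn_ge0.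
by rewrite conj_Creal ?ger0_real// ler_wpM2r// lecR.
Qed.

(** The exchange of [a] and [a'] in the second hypothesis is the partial transpose of the Choi
    matrix on the input. The next two hypotheses ask for one common diagonal partial trace [m] for
    both families. *)
Theorem coherent_info_le (TA TB TE S : finType) (W : TA -> TB -> TE -> C)
    (g h : S -> TA -> TB -> C) (m : TA -> R) (L : R) (rho : 'M[C]_#|TA|) :
  (forall a a', \sum_b \sum_e W a b e * (W a' b e)^* = (a == a')%:R) ->
  (forall a b a' b', \sum_e W a b e * (W a' b' e)^*
     = \sum_s g s a' b * (h s a b')^*) ->
  (forall a a', \sum_s \sum_b g s a b * (g s a' b)^* = (m a)%:C%C *+ (a == a')) ->
  (forall a a', \sum_s \sum_b h s a b * (h s a' b)^* = (m a)%:C%C *+ (a == a')) ->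
  (forall a, m a <= L) -> 0 < L -> is_density rho ->
  vN_entropy (chan_out W rho) - vN_entropy (chan_comp W rho) <= ln L / ln 2.
Proof.
move=> W1 Wgh gm hm mL L0 rhoD; have [X rhoE] := density_factor rhoD.
have trX : \tr (X *m X^t*) = 1 by rewrite -rhoE; case: rhoD => _ [].
pose Wm (e : 'I_#|TE|) := coeff_mx (fun a b => W a b (enum_val e)).
pose Psi (r : 'I_#|TA|) := \matrix_(b, e) (Wm e *m X) b r.
pose cX := map_mx Num.conj X.
pose Ga s := coeff_mx (g s) *m cX; pose Et s := coeff_mx (h s) *m cX.
pose om := 2^-1 *: (\sum_s Ga s *m (Ga s)^t* + \sum_s Et s *m (Et s)^t*).
have WrhoE e f : Wm e *m X *m (Wm f *m X)^t* = Wm e *m rho *m (Wm f)^t*.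
  by rewrite trmxC_mul rhoE !mulmxA.
have outE : chan_out W rho = \sum_r Psi r *m (Psi r)^t*.
  apply/matrixP => i j; rewrite mxE summxE -sum_enum_val.
  under [RHS]eq_bigr do rewrite mxE; rewrite [RHS]exchange_big /=.
  apply: eq_bigr => e _; rewrite -(coeff_mx_conjE (fun a b => W a b (enum_val e))
    (fun a b => W a b (enum_val e))) -WrhoE mxE.
  by apply: eq_bigr => r _; rewrite !mxE.
have compE : chan_comp W rho = \sum_r (Psi r)^T *m ((Psi r)^T)^t*.
  apply/matrixP => i j; rewrite mxE summxE -sum_enum_val.
  under [RHS]eq_bigr do rewrite mxE; rewrite [RHS]exchange_big /=.
  apply: eq_bigr => b _; rewrite -(coeff_mx_conjE (fun a b => W a b (enum_val i))
    (fun a b => W a b (enum_val j))) -WrhoE mxE.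
  by apply: eq_bigr => r _; rewrite !mxE.
rewrite compE [in X in X - _]outE.
have omE (v : 'rV[C]_#|TB|) : (v *m om *m v^t*) 0 0 = 2^-1 *
    (\sum_s \sum_r `|(v *m Ga s) 0 r| ^+ 2 + \sum_s \sum_r `|(v *m Et s) 0 r| ^+ 2).
  have addE (A B : 'M[C]_1) : (A + B) 0 0 = A 0 0 + B 0 0 by rewrite mxE.
  have scaleE k (A : 'M[C]_1) : (k *: A) 0 0 = k * A 0 0 by rewrite mxE.
  by rewrite /om -scalemxAr -scalemxAl scaleE mulmxDr mulmxDl addE !gram_form.
apply: (vN_entropy_sub_le (om := om)) => //.
- rewrite -outE -trX -rhoE /mxtrace.
  transitivity (\sum_a \sum_a' rho (enum_rank a) (enum_rank a') * (a == a')%:R).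
    under eq_bigr do rewrite mxE.
    rewrite (sum_enum_val (fun b => \sum_e \sum_a \sum_a' W a b e
      * rho (enum_rank a) (enum_rank a') * (W a' b e)^*)).
    under eq_bigr do rewrite exchange_big /=; rewrite exchange_big /=.
    apply: eq_bigr => a _; under eq_bigr do rewrite exchange_big /=.
    rewrite exchange_big /=; apply: eq_bigr => a' _; rewrite -W1 mulr_sumr.
    apply: eq_bigr => b _; rewrite mulr_sumr; apply: eq_bigr => e _; ring.
  rewrite -[LHS]sum_enum_val; apply: eq_bigr => i _.
  rewrite (bigD1 (enum_val i))//= eqxx mulr1 enum_valK big1 ?addr0// => a' /negPf.
  by rewrite eq_sym => ->; rewrite mulr0.
- by apply: hermsymmx_half_add; apply: gram_hermsymmx.
- move=> v; rewrite omE mulr_ge0 ?invr_ge0 ?ler0n// addr_ge0// sumr_ge0// => s _;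
  by rewrite sumr_ge0// => r _; rewrite exprn_ge0.
- rewrite /om mxtraceZ mxtraceD ler_pdivrMl ?ltr0n//.
  rewrite [leRHS]mulr_natl mulr2n lerD//; exact: marginal_trace_le.
(* Stacking the [y r] as rows of [Y] makes the e-th entry of sum_r y_r Psi_r equal to tr (Y W_e X),
   the quantity bounded by [twisted_trace_le]. *)
- move=> y; pose Y := \matrix_(r, b) y r 0 b.
  have rowY r k (M : 'M[C]_(#|TB|, k)) c : (Y *m M) r c = (y r *m M) 0 c.
    by rewrite !mxE; apply: eq_bigr => b _; rewrite !mxE.
  have -> : \sum_r (y r *m om *m (y r)^t*) 0 0 = 2^-1 *
    (\sum_s \sum_r \sum_r' `|(Y *m coeff_mx (g s) *m cX) r r'| ^+ 2
    + \sum_s \sum_r \sum_r' `|(Y *m coeff_mx (h s) *m cX) r r'| ^+ 2).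
    under eq_bigr do rewrite omE.
    rewrite -mulr_sumr big_split /=; congr (_ * (_ + _)); rewrite exchange_big /=;
    apply: eq_bigr => s _; apply: eq_bigr => r _; apply: eq_bigr => r' _;
    by rewrite -mulmxA rowY.
  rewrite mulmxtC_diag; apply: le_trans (twisted_trace_le (W := Wm) X Y _).
    rewrite le_eqVlt; apply/orP; left; apply/eqP; apply: eq_bigr => e _.
    congr (`|_| ^+ 2); rewrite summxE /mxtrace; apply: eq_bigr => r _.
    by rewrite -mulmxA rowY !mxE; apply: eq_bigr => b _; rewrite !mxE.
  move=> b a b' a'; rewrite -[LHS]/(\sum_e _) .
  under eq_bigr do rewrite !mxE.
  rewrite (sum_enum_val (fun e => W (enum_val a) (enum_val b) e
    * (W (enum_val a') (enum_val b') e)^*)) Wgh.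
  by apply: eq_bigr => s _; rewrite !mxE.
Qed.

End Coh.

(** * Tensor powers *)

Section Tensor.
Variable R : realType.
Local Notation C := R[i].

Lemma sum_ffun_prod n (T : finType) (F : 'I_n -> T -> C) :
  \sum_(f : {ffun 'I_n -> T}) \prod_k F k (f k) = \prod_k \sum_x F k x.
Proof. by rewrite bigA_distr_bigA. Qed.

Lemma sum2_ffun_prod n (T U : finType) (F : 'I_n -> T -> U -> C) :
  \sum_(f : {ffun 'I_n -> T}) \sum_(f' : {ffun 'I_n -> U}) \prod_k F k (f k) (f' k)
  = \prod_k \sum_x \sum_y F k x y.
Proof.
rewrite -sum_ffun_prod; apply: eq_bigr => f _.
by rewrite (sum_ffun_prod (fun k => F k (f k))).
Qed.

Lemma prod_eq_ffun n (T : finType) (a a' : {ffun 'I_n -> T}) :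
  \prod_k (a k == a' k)%:R = (a == a')%:R :> C.
Proof.
have [->|/eqP aa'] := eqVneq a a'; first by rewrite big1// => k _; rewrite eqxx.
have [k /negPf ak] : exists k, a k != a' k.
  apply/existsP; rewrite -negb_forall; apply/negP => /forallP H; apply: aa'.
  by apply/ffunP => k; apply/eqP.
by rewrite (bigD1 k)//= ak mul0r.
Qed.

(** Each identity in the hypotheses equates sums of products, so it passes to tuples by distributing
    sums over products: [g], [h] and [m] are replaced by their products over the [n] factors, and
    [L] by its power. *)
Theorem qcap_le (TA TB TE S : finType) (W : TA -> TB -> TE -> C)
    (g h : S -> TA -> TB -> C) (m : TA -> R) (L : R) :
  (forall a a', \sum_b \sum_e W a b e * (W a' b e)^* = (a == a')%:R) ->
  (forall a b a' b', \sum_e W a b e * (W a' b' e)^*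
     = \sum_s g s a' b * (h s a b')^*) ->
  (forall a a', \sum_s \sum_b g s a b * (g s a' b)^* = (m a)%:C%C *+ (a == a')) ->
  (forall a a', \sum_s \sum_b h s a b * (h s a' b)^* = (m a)%:C%C *+ (a == a')) ->
  (forall a, 0 <= m a <= L) -> 1 <= L ->
  qcap W <= log2 L.
Proof.
move=> W1 Wgh gm hm mL L1.
have L0 : 0 < L := lt_le_trans ltr01 L1.
have ln20 : 0 < (ln 2 : R) by rewrite ln_gt0 ?ltr1n.
have logL : 0 <= log2 L by apply: divr_ge0; [exact: ln_ge0|exact: ltW].
pose pw n (f : S -> TA -> TB -> C) (s : {ffun 'I_n -> S}) (a : {ffun 'I_n -> TA})
  (b : {ffun 'I_n -> TB}) := \prod_k f (s k) (a k) (b k).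
have pwm n f : (forall a a', \sum_s \sum_b f s a b * (f s a' b)^* = (m a)%:C%C *+ (a == a')) ->
    forall a a', \sum_s \sum_b pw n f s a b * (pw n f s a' b)^*
      = (\prod_k m (a k))%:C%C *+ (a == a').
  move=> fm a a'; transitivity
    (\sum_(s : {ffun 'I_n -> S}) \sum_(b : {ffun 'I_n -> TB})
      \prod_k (f (s k) (a k) (b k) * (f (s k) (a' k) (b k))^*)).
    by apply: eq_bigr => s _; apply: eq_bigr => b _; rewrite rmorph_prod -big_split.
  rewrite (sum2_ffun_prod (fun k y x => f y (a k) x * (f y (a' k) x)^*)).
  under eq_bigr do rewrite fm -mulr_natr.
  by rewrite big_split /= prod_eq_ffun rmorph_prod mulr_natr.
have coh n : coh_info (iso_tpow n.+1 W) <= log2 L *+ n.+1.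
  rewrite /coh_info; set A := (X in sup X).
  (* The supremum of the empty set is 0 by convention, which is fine since 1 <= L makes [log2 L]
     nonnegative. *)
  have [->|A0] := eqVneq A set0; first by rewrite sup0 mulrn_wge0.
  apply: ge_sup; first exact/set0P.
  move=> _ [rho [rhoD ->]].
  rewrite /log2 -mulrnAl -lnXn//.
  apply: (coherent_info_le (g := pw n.+1 g) (h := pw n.+1 h)
    (m := fun a => \prod_k m (a k))) => //.
  - move=> a a'; rewrite /iso_tpow; transitivity
      (\sum_(b : {ffun 'I_n.+1 -> TB}) \sum_(e : {ffun 'I_n.+1 -> TE})
        \prod_k (W (a k) (b k) (e k) * (W (a' k) (b k) (e k))^*)).
      by apply: eq_bigr => b _; apply: eq_bigr => e _; rewrite rmorph_prod -big_split.
    rewrite (sum2_ffun_prod (fun k y x => W (a k) y x * (W (a' k) y x)^*)).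
    by under eq_bigr do rewrite W1; rewrite prod_eq_ffun.
  - move=> a b a' b'; rewrite /iso_tpow /pw; transitivity
      (\sum_(e : {ffun 'I_n.+1 -> TE})
        \prod_k (W (a k) (b k) (e k) * (W (a' k) (b' k) (e k))^*)).
      by apply: eq_bigr => e _; rewrite rmorph_prod -big_split.
    rewrite (sum_ffun_prod (fun k x => W (a k) (b k) x * (W (a' k) (b' k) x)^*)).
    under eq_bigr do rewrite Wgh.
    rewrite -(sum_ffun_prod (fun k x => g x (a' k) (b k) * (h x (a k) (b' k))^*)).
    by apply: eq_bigr => s _; rewrite rmorph_prod -big_split.
  - exact: pwm.
  - exact: pwm.
  (* Multiplying the bounds m <= L factor by factor uses 0 <= m. *)
  - move=> a; rewrite -[n.+1 in leRHS]card_ord -prodr_const; exact: ler_prod.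
  - exact: exprn_gt0.
have bnd n : coh_info (iso_tpow n.+1 W) / n.+1%:R <= log2 L.
  by rewrite ler_pdivrMr ?ltr0n// mulr_natr.
rewrite /qcap; set u := (X in limn X).
have [cu|ncu] := pselect (cvgn u).
  by apply: limr_le => //; apply: nearW => n; exact: bnd.
(* [limn] of a divergent sequence is [0]. *)
by rewrite dvgP.
Qed.
End Tensor.

(** * The platypus channel *)

Section Platypus.
Variables (R : realType) (d : nat) (mu : 'I_d -> R).

(** Indicators with values in [R] replace the case distinctions of [platypus_iso] by polynomial
    expressions, open to [ring]. The shift in [inS] reflects that V sends |i+1> to |d>|i>. *)
Definition in0 (a : 'I_d.+1) : R := (a == 0%N :> nat)%:R.
Definition inS (a : 'I_d.+1) (i : 'I_d) : R := (a == i.+1 :> nat)%:R.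
Definition outd (b : 'I_d.+1) : R := (b == d :> nat)%:R.
Definition outj (b : 'I_d.+1) (j : 'I_d) : R := (b == j :> nat)%:R.

Definition platypus_coeff a b e : R :=
  in0 a * outj b e * Num.sqrt (mu e) + inS a e * outd b.

Lemma platypus_isoE a b e : platypus_iso mu a b e = (platypus_coeff a b e)%:C%C.
Proof.
rewrite /platypus_iso /platypus_coeff /in0 /inS /outj /outd.
case: a => [[|a] lta] /=.
  by rewrite mul0r addr0 mul1r; case: eqP => _; rewrite ?mul1r ?mul0r.
rewrite !mul0r add0r eqSS andbC [a == _]eq_sym -natrM mulnb.
by case: ifP.
Qed.

Lemma sum_outd : \sum_b outd b * outd b = 1.
Proof.
rewrite big_ord_recr /= /outd eqxx mulr1 big1 ?add0r// => b _ /=.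
by rewrite ltn_eqF ?mul0r.
Qed.

Lemma sum_outj j k : \sum_b outj b j * outj b k = (j == k)%:R.
Proof.
rewrite big_ord_recr /= /outj [d == j]gtn_eqF// mul0r addr0.
rewrite (bigD1 j)//= eqxx mul1r big1 ?addr0// => i /negPf ij.
by rewrite (_ : (i == j :> nat) = false) ?mul0r.
Qed.

Lemma sum_outdj j : \sum_b outd b * outj b j = 0.
Proof.
rewrite big1// => b _; rewrite /outd /outj -natrM mulnb.
by case: eqP => [->|//]; rewrite gtn_eqF.
Qed.

Lemma in0M a a' : in0 a * in0 a' = in0 a * (a == a')%:R.
Proof.
rewrite /in0 -!natrM !mulnb -(inj_eq val_inj) /=.
by case: eqP => //= ->; rewrite eq_sym.
Qed.

Lemma inSM a a' i : inS a i * inS a' i = inS a i * (a == a')%:R.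
Proof.
rewrite /inS -!natrM !mulnb -(inj_eq val_inj) /=.
by case: eqP => //= ->; rewrite eq_sym.
Qed.

Lemma sum_inS (F : 'I_d -> R) (i : 'I_d) (a : 'I_d.+1) : a = i.+1 :> nat ->
  \sum_k inS a k * F k = F i.
Proof.
move=> ai; rewrite (bigD1 i)//= /inS ai eqxx mul1r big1 ?addr0// => k /negPf ki.
by rewrite eqSS eq_sym (_ : (k == i :> nat) = false) ?mul0r.
Qed.

Hypotheses (mu0 : forall j, 0 <= mu j) (mu1 : \sum_j mu j = 1).

Lemma in_resolution a : in0 a + \sum_k inS a k = 1.
Proof.
under eq_bigr do rewrite -[inS _ _]mulr1.
case: a => [[|a] lta].
  by rewrite big1 ?addr0// => k _; rewrite mul0r.
by rewrite (@sum_inS _ (Ordinal (lta : (a < d)%N)))// add0r.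
Qed.

(** The cross terms between |0> and the other inputs vanish because their outputs |j>, j < d, and
    |d> are orthogonal. *)
Lemma platypus_isometry a a' :
  \sum_b \sum_e platypus_coeff a b e * platypus_coeff a' b e = (a == a')%:R.
Proof.
rewrite exchange_big /=.
transitivity (\sum_e (in0 a * in0 a' * mu e + inS a e * inS a' e)).
  apply: eq_bigr => e _.
  have -> : in0 a * in0 a' * mu e + inS a e * inS a' e =
    in0 a * in0 a' * mu e * (\sum_b outj b e * outj b e)
    + (in0 a * inS a' e + inS a e * in0 a') * Num.sqrt (mu e) * (\sum_b outd b * outj b e)
    + inS a e * inS a' e * (\sum_b outd b * outd b).
    by rewrite sum_outj sum_outdj sum_outd eqxx mulr1n; ring.
  rewrite !mulr_sumr -!big_split; apply: eq_bigr => b _ /=.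
  rewrite /platypus_coeff; set r := Num.sqrt (mu e).
  have -> : mu e = r ^+ 2 by rewrite sqr_sqrtr.
  ring.
rewrite big_split /= -mulr_sumr mu1 mulr1 in0M.
under eq_bigr do rewrite inSM.
by rewrite -mulr_suml -mulrDl in_resolution mul1r.
Qed.

(* The partial transpose of the Choi matrix is block diagonal; its only
   non-diagonal block swaps [u = sum_i sqrt (mu i) |i+1, i>] and [|0, d>], and
   is written as [|al u><0,d| / al] plus its adjoint.  Below, [al] is chosen as
   [(max mu)^(-1/4)], which equalises the bounds on the two partial traces. *)
Definition platypus_factor (al : R) (s : 'I_d + 'I_d + bool) a b : R :=
  match s with
  | inl (inl j) => in0 a * outj b j * Num.sqrt (mu j)
  | inl (inr i) => inS a i * outd b
  | inr true => al * \sum_k inS a k * outj b k * Num.sqrt (mu k)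
  | inr false => al^-1 * (in0 a * outd b)
  end.

(** The family [h] is [g] relabelled by this involution: diagonal terms are paired with themselves,
    and the two halves of the swapped block with each other. *)
Definition swap_bool (s : 'I_d + 'I_d + bool) :=
  match s with inl t => inl t | inr c => inr (~~ c) end.

(** The four products obtained by expanding the left side match the four kinds of labels; in the two
    cross terms [al] cancels its inverse. *)
Lemma platypus_factorE al a b a' b' : al != 0 ->
  \sum_e platypus_coeff a b e * platypus_coeff a' b' e =
  \sum_s platypus_factor al s a' b * platypus_factor al (swap_bool s) a b'.
Proof.
move=> al0; rewrite !big_sumType big_bool /=.
rewrite !mulr_sumr !mulr_suml -!big_split /=.
apply: eq_bigr => e _; rewrite /platypus_coeff; field.
by [].
Qed.

(** Diagonal of the partial trace over B of sum_s |g_s><g_s|. Increasing [al] moves weight from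
    input |0> to the inputs |k+1>. *)
Definition platypus_marginal (al : R) a :=
  in0 a * (1 + al^-1 ^+ 2) + \sum_k inS a k * (1 + al ^+ 2 * mu k).

Lemma platypus_factor_marginal al a a' :
  \sum_s \sum_b platypus_factor al s a b * platypus_factor al s a' b =
  platypus_marginal al a *+ (a == a').
Proof.
have E1 : \sum_j \sum_b (in0 a * outj b j * Num.sqrt (mu j))
    * (in0 a' * outj b j * Num.sqrt (mu j)) = in0 a * in0 a'.
  rewrite -[RHS]mulr1 -mu1 mulr_sumr; apply: eq_bigr => j _.
  have -> : in0 a * in0 a' * mu j = in0 a * in0 a' * mu j * \sum_b outj b j * outj b j.
    by rewrite sum_outj eqxx mulr1.
  rewrite mulr_sumr.
  set r := Num.sqrt (mu j); have -> : mu j = r ^+ 2 by rewrite sqr_sqrtr.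
  by apply: eq_bigr => b _; ring.
have E2 : \sum_i \sum_b (inS a i * outd b) * (inS a' i * outd b)
    = \sum_i inS a i * inS a' i.
  apply: eq_bigr => i _; rewrite -[RHS]mulr1 -sum_outd mulr_sumr.
  by apply: eq_bigr => b _; ring.
(* The contribution of [al] u: orthonormality of the |j> in B collapses the double sum over [k] and
   [l] to its diagonal. *)
have E3 : \sum_b (al * \sum_k inS a k * outj b k * Num.sqrt (mu k))
    * (al * \sum_k inS a' k * outj b k * Num.sqrt (mu k))
    = al ^+ 2 * \sum_k inS a k * inS a' k * mu k.
  transitivity (al ^+ 2 * \sum_k \sum_l inS a k * inS a' l
      * Num.sqrt (mu k) * Num.sqrt (mu l) * \sum_b outj b k * outj b l).
    under [in RHS]eq_bigr do under eq_bigr do rewrite mulr_sumr.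
    under [in RHS]eq_bigr do rewrite exchange_big /=.
    rewrite [in RHS]exchange_big mulr_sumr; apply: eq_bigr => b _ /=.
    rewrite mulrACA -expr2 mulr_suml; congr (_ * _); apply: eq_bigr => k _.
    by rewrite mulr_sumr; apply: eq_bigr => l _; ring.
  congr (_ * _); apply: eq_bigr => k _; rewrite (bigD1 k)//= [X in _ + X]big1 ?addr0.
    set r := Num.sqrt (mu k); have -> : mu k = r ^+ 2 by rewrite sqr_sqrtr.
    by rewrite sum_outj eqxx mulr1n; ring.
  by move=> l /negPf lk; rewrite sum_outj eq_sym lk mulr0.
have E4 : \sum_b (al^-1 * (in0 a * outd b)) * (al^-1 * (in0 a' * outd b))
    = al^-1 ^+ 2 * (in0 a * in0 a').
  rewrite -[RHS]mulr1 -sum_outd mulr_sumr; apply: eq_bigr => b _; ring.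
rewrite !big_sumType big_bool /= E1 E2 E3 E4 in0M -mulr_natr /platypus_marginal.
have -> : \sum_k inS a k * (1 + al ^+ 2 * mu k) = \sum_k inS a k
    + al ^+ 2 * \sum_k inS a k * mu k.
  by rewrite mulr_sumr -big_split; apply: eq_bigr => k _ /=; ring.
under eq_bigr do rewrite inSM.
under [X in _ + (al ^+ 2 * X + _)]eq_bigr do rewrite inSM mulrAC.
rewrite -!mulr_suml; ring.
Qed.

Lemma bigmax_mu_gt0 : 0 < \big[Num.max/0]_j mu j.
Proof.
rewrite lt_neqAle bigmax_ge_id andbT; apply/eqP => M0.
have := oner_neq0 R; rewrite -mu1 big1 ?eqxx// => j _; apply/eqP.
by rewrite eq_le mu0 andbT M0 le_bigmax.
Qed.

(** Since al^2 = 1 / sqrt M, the value at input |0> is exactly 1 + sqrt M, and mu_k <= M gives the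
    same bound at |k+1>. *)
Lemma platypus_marginal_le a (M := \big[Num.max/0]_j mu j)
    (al := Num.sqrt (Num.sqrt M)^-1) :
  0 <= platypus_marginal al a <= 1 + Num.sqrt M.
Proof.
have M0 : 0 < M := bigmax_mu_gt0.
have sM0 : 0 < Num.sqrt M by rewrite sqrtr_gt0.
have alE : al ^+ 2 = (Num.sqrt M)^-1 by rewrite sqr_sqrtr ?invr_ge0 ?ltW.
rewrite /platypus_marginal exprVn alE invrK.
case: a => [[|a] lta].
  rewrite big1 => [|k _]; last by rewrite mul0r.
  by rewrite addr0 mul1r lexx andbT addr_ge0// ltW.
rewrite (@sum_inS _ (Ordinal (lta : (a < d)%N)))// mul0r add0r.
rewrite addr_ge0 ?mulr_ge0 ?invr_ge0 ?sqrtr_ge0//= lerD2l.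
rewrite ler_pdivrMl// -expr2 sqr_sqrtr; first exact: le_bigmax.
exact: ltW.
Qed.

End Platypus.

Theorem theorem1 (R : realType) (d : nat) (mu : 'I_d -> R) :
  (0 < d)%N ->
  (forall j, 0 <= mu j) ->
  \sum_(j < d) mu j = 1 ->
  qcap (platypus_iso mu) <= log2 (1 + Num.sqrt (\big[Num.max/0]_(j < d) mu j)).
Proof.
move=> _ mu0 mu1; set M := \big[Num.max/0]_j mu j.
pose al : R := Num.sqrt (Num.sqrt M)^-1.
pose g s a b : R[i] := (platypus_factor mu al s a b)%:C%C.
have swapK : involutive (@swap_bool d) by case=> [//|[]].
have realM (x y : R) : x%:C%C * (y%:C%C)^* = (x * y)%:C%C.
  by rewrite conj_Creal ?complex_real// rmorphM.
have gm a a' : \sum_s \sum_b g s a b * (g s a' b)^*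
    = (platypus_marginal mu al a)%:C%C *+ (a == a').
  rewrite -mulr_natr -(rmorph_nat (real_complex R)) -rmorphM /= mulr_natr.
  rewrite -platypus_factor_marginal// rmorph_sum; apply: eq_bigr => s _ /=.
  by rewrite rmorph_sum; apply: eq_bigr => b _; rewrite /g realM.
apply: (qcap_le (g := g) (h := g \o @swap_bool d) (m := platypus_marginal mu al)).
- move=> a a'; rewrite -(rmorph_nat (real_complex R)) -(platypus_isometry mu0 mu1).
  rewrite rmorph_sum; apply: eq_bigr => b _; rewrite rmorph_sum.
  by apply: eq_bigr => e _; rewrite !platypus_isoE realM.
- move=> a b a' b'.
  transitivity ((\sum_e platypus_coeff mu a b e * platypus_coeff mu a' b' e)%:C%C).
    by rewrite rmorph_sum; apply: eq_bigr => e _; rewrite !platypus_isoE realM.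
  rewrite (@platypus_factorE _ _ _ al); last first.
    by rewrite gt_eqF// sqrtr_gt0 invr_gt0 sqrtr_gt0 bigmax_mu_gt0.
  by rewrite rmorph_sum; apply: eq_bigr => s _; rewrite /g realM.
- exact: gm.
(* Relabelling by an involution does not change the sum over [s], so [h] has the same partial trace
   as [g]. *)
- move=> a a'; rewrite -gm [RHS](reindex_inj (inv_inj swapK)) /=.
  by apply: eq_bigr.
- by move=> a; exact: platypus_marginal_le.
- by rewrite lerDl sqrtr_ge0.
Qed.
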